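(* Let $R$ be a simple semiring and $I$ a nonzero left ideal of $R$. Let $D=\mathrm{End}({}_RI)$, viewed as a semiring of right operators on $I$. Then the natural map $f:R\to \mathrm{End}(I_D)$, $f(r)(i)=ri$ for $r\in R$, $i\in I$, is a semiring isomorphism; the semimodule ${}_RI$ is a generator in the category ${}_R\mathcal{M}$; and $I_D$ is a finitely generated projective right $D$-semimodule. Moreover, there are an integer $n\ge 1$ and a nonzero idempotent $e$ of the matrix semiring $M_n(D)$ such that the semirings $R$ and $eM_n(D)e$ are isomorphic; and the semiring $D$ is simple if and only if the left ideal $I$ is a finitely generated projective left $R$-semimodule.
   Context: A semiring $(R,+,\cdot,0,1)$ consists of a commutative monoid $(R,+,0)$ and a monoid $(R,\cdot,1)$ such that multiplication distributes over addition on both sides and $0r=0=r0$ for all $r\in R$. An ideal (left ideal) is an additive submonoid closed under two-sided (left) multiplication by elements of $R$. $R$ is ideal-simple if $0$ and $R$ are its only ideals; congruence-simple if the diagonal and $R^2$ are its only congruences; simple if it is both. A left $R$-semimodule is a commutative monoid $M$ with a unital, associative scalar multiplication $R\times M\to M$ that is additive in each variable and satisfies $r0_M=0_M=0m$; right semimodules are defined dually; ${}_R\mathcal{M}$ and $\mathcal{M}_R$ denote the categories of left and right $R$-semimodules. A semimodule is free if it is a direct sum of copies of the regular semimodule, projective if it is a retract of a free semimodule, and finitely generated if it is a homomorphic image of a free semimodule with finite basis. A semimodule ${}_RP$ is a generator for ${}_R\mathcal{M}$ if the regular semimodule ${}_RR$ is a retract of a finite direct sum of copies of ${}_RP$. $\mathrm{End}({}_RI)$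 is the semiring of $R$-endomorphisms of $I$, with multiplication such that $I$ becomes a right $D$-semimodule $I_D$ (endomorphisms written on the right), and $\mathrm{End}(I_D)$ is the semiring of $D$-endomorphisms of $I_D$, written on the left, with pointwise addition and composition. For an idempotent $e$ of a semiring $T$, $eTe$ is a semiring with identity $e$. *)

(* Defs.v *)
From HB Require Import structures.
From mathcomp Require Import all_boot all_algebra.
From mathcomp Require Import boolp classical_sets functions cardinality.

Set Implicit Arguments.
Unset Strict Implicit.
Unset Printing Implicit Defensive.

Import GRing.Theory.

Local Open Scope classical_set_scope.
Local Open Scope ring_scope.

(* Semirings are pzSemiRingType and left semimodules are lSemiModType.  A right
   semimodule over D is a left semimodule over the converse semiring D^c. *)
Notation rSemiModType D := (lSemiModType D^c).

Section Simplicity.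
Variable R : pzSemiRingType.

Definition add_submonoid (J : set R) : Prop :=
  J 0 /\ (forall x y, J x -> J y -> J (x + y)).

Definition left_ideal (J : set R) : Prop :=
  add_submonoid J /\ (forall r x, J x -> J (r * x)).

Definition two_sided_ideal (J : set R) : Prop :=
  add_submonoid J /\ (forall r x, J x -> J (r * x) /\ J (x * r)).

Definition ideal_simple : Prop :=
  forall J : set R, two_sided_ideal J -> J = [set 0] \/ J = setT.

Record congruence (E : R -> R -> Prop) : Prop := Congruence {
  congr_refl : forall x, E x x;
  congr_sym : forall x y, E x y -> E y x;
  congr_trans : forall x y z, E x y -> E y z -> E x z;
  congr_add : forall x y u v, E x y -> E u v -> E (x + u) (y + v);
  congr_mul : forall x y u v, E x y -> E u v -> E (x * u) (y * v)
}.

Definition congruence_simple : Prop :=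
  forall E : R -> R -> Prop, congruence E ->
    (forall x y, E x y <-> x = y) \/ (forall x y, E x y).

Definition simple_semiring : Prop := ideal_simple /\ congruence_simple.

End Simplicity.

Definition semiring_isomorphic (S T : pzSemiRingType) : Prop :=
  exists f : {rmorphism S -> T}, bijective f.

(* The direct sum of copies of M indexed by X: finitely supported functions. *)
Section DirectSum.
Variables (R : pzSemiRingType) (X : choiceType) (M : lSemiModType R).

Definition fin_supp : {pred (X -> M)} :=
  fun f => `[< finite_set [set x | f x != 0] >].

Record dsum := DSum { dsum_fun :> X -> M; _ : dsum_fun \in fin_supp }.

HB.instance Definition _ := [isSub for dsum_fun].
HB.instance Definition _ := [Choice of dsum by <:].

Lemma fin_supp_nmod_closed : GRing.nmod_closed fin_supp.
Proof.
split=> [|f g /asboolP ff /asboolP fg]; apply/asboolP.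
  have -> : [set x | (0 : X -> M) x != 0] = set0 by
    apply/seteqP; split=> x //=; rewrite eqxx.
  exact: finite_set0.
apply: (@sub_finite_set _ _ ([set x | f x != 0] `|` [set x | g x != 0])).
  move=> x /=; have [fx0|fx _] := eqVneq (f x) 0; last by left.
  have -> : (f + g) x = g x by rewrite -[RHS]add0r -fx0.
  by right.
by rewrite finite_setU.
Qed.

HB.instance Definition _ :=
  GRing.SubChoice_isSubNmodule.Build (X -> M) fin_supp dsum fin_supp_nmod_closed.

Lemma fin_supp_scale (a : R) (f : dsum) : (fun x => a *: f x) \in fin_supp.
Proof.
case: f => f /= /asboolP ff; apply/asboolP; apply: sub_finite_set ff => x /=.
by apply: contra => /eqP ->; rewrite scaler0.
Qed.

Definition dsum_scale (a : R) (f : dsum) : dsum := DSum (fin_supp_scale a f).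

Lemma dsum_scaleA a b f : dsum_scale a (dsum_scale b f) = dsum_scale (a * b) f.
Proof. by apply/val_inj/funext => x /=; rewrite scalerA. Qed.
Lemma dsum_scale0 f : dsum_scale 0 f = 0.
Proof. by apply/val_inj/funext => x; rewrite /= scale0r. Qed.
Lemma dsum_scale1 : left_id 1 dsum_scale.
Proof. by move=> f; apply/val_inj/funext => x /=; rewrite scale1r. Qed.
Lemma dsum_scaleDr : right_distributive dsum_scale +%R.
Proof. by move=> a f g; apply/val_inj/funext => x; rewrite /= scalerDr. Qed.
Lemma dsum_scaleDl f : {morph dsum_scale^~ f : a b / a + b}.
Proof. by move=> a b; apply/val_inj/funext => x; rewrite /= scalerDl. Qed.

HB.instance Definition _ := GRing.Nmodule_isLSemiModule.Build R dsum
  dsum_scaleA dsum_scale0 dsum_scale1 dsum_scaleDr dsum_scaleDl.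

End DirectSum.

Section SemimoduleNotions.
Variable R : pzSemiRingType.
Implicit Types M N P : lSemiModType R.

Definition retract_of N M : Prop :=
  exists (s : {linear N -> M}) (p : {linear M -> N}), cancel s p.

(* R^o is the regular semimodule, so dsum X R^o is the free one on X. *)
Definition projective P : Prop :=
  exists X : choiceType, retract_of P (dsum X R^o).

Definition finitely_generated M : Prop :=
  exists (n : nat) (p : {linear dsum 'I_n R^o -> M}), forall y, exists x, p x = y.

Definition generator P : Prop :=
  exists n : nat, retract_of R^o (dsum 'I_n P).

End SemimoduleNotions.

(* Endomorphisms of a left semimodule M, written on the left: the product is
   composition, (f * g) x = f (g x). *)
Section Endomorphisms.
Variables (R : pzSemiRingType) (M : lSemiModType R).

Definition endo : Type := {linear M -> M}.

HB.instance Definition _ := gen_eqMixin endo.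
HB.instance Definition _ := gen_choiceMixin endo.

Definition endo_fun (f : endo) : M -> M := (f : {linear M -> M}).
Coercion endo_fun : endo >-> Funclass.

Lemma endoP (f g : endo) : f =1 g -> f = g.
Proof.
rewrite /endo_fun; case: f g => [f [[[f0 fD]] [fZ]]] [g [[[g0 gD]] [gZ]]] /=.
move=> /funext fg; subst g.
by rewrite (Prop_irrelevance f0 g0) (Prop_irrelevance fD gD)
           (Prop_irrelevance fZ gZ).
Qed.

Definition endo_zero : endo := (\0 : M -> M) : {linear M -> M}.
Definition endo_add (f g : endo) : endo :=
  ((f : {linear M -> M}) \+ (g : {linear M -> M})) : {linear M -> M}.
Definition endo_one : endo := (idfun : M -> M) : {linear M -> M}.
Definition endo_mul (f g : endo) : endo :=
  ((f : {linear M -> M}) \o (g : {linear M -> M})) : {linear M -> M}.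

Fact endo_addA : associative endo_add.
Proof. by move=> f g h; apply: endoP => x; exact: addrA. Qed.
Fact endo_addC : commutative endo_add.
Proof. by move=> f g; apply: endoP => x; exact: addrC. Qed.
Fact endo_add0 : left_id endo_zero endo_add.
Proof. by move=> f; apply: endoP => x; exact: add0r. Qed.
Fact endo_mulA : associative endo_mul.
Proof. by move=> f g h; apply: endoP. Qed.
Fact endo_mul1 : left_id endo_one endo_mul.
Proof. by move=> f; apply: endoP. Qed.
Fact endo_1mul : right_id endo_one endo_mul.
Proof. by move=> f; apply: endoP. Qed.
Fact endo_mulDl : left_distributive endo_mul endo_add.
Proof. by move=> f g h; apply: endoP. Qed.
Fact endo_mulDr : right_distributive endo_mul endo_add.
Proof. by move=> f g h; apply: endoP => x; exact: linearD. Qed.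
Fact endo_mul0 : left_zero endo_zero endo_mul.
Proof. by move=> f; apply: endoP. Qed.
Fact endo_0mul : right_zero endo_zero endo_mul.
Proof. by move=> f; apply: endoP => x; exact: linear0. Qed.

HB.instance Definition _ := GRing.isPzSemiRing.Build endo
  endo_addA endo_addC endo_add0 endo_mulA endo_mul1 endo_1mul
  endo_mulDl endo_mulDr endo_mul0 endo_0mul.

(* With endomorphisms written on the right, x (f g) = (x f) g; hence the
   semiring of right operators is the converse of endo. *)
Definition rendo : pzSemiRingType := endo^c.

(* M as a right semimodule over rendo: the action x f of f on x is f x. *)
Definition bimod : Type := M.

HB.instance Definition _ := GRing.Nmodule.on bimod.

Definition bimod_scale (f : rendo^c) (x : bimod) : bimod := (f : endo) x.

Fact bimod_scaleA f g x :
  bimod_scale f (bimod_scale g x) = bimod_scale (f * g) x.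
Proof. by []. Qed.
Fact bimod_scale0 x : bimod_scale 0 x = 0.
Proof. by []. Qed.
Fact bimod_scale1 : left_id 1 bimod_scale.
Proof. by []. Qed.
Fact bimod_scaleDr : right_distributive bimod_scale +%R.
Proof. by move=> f x y; exact: (linearD (f : {linear M -> M})). Qed.
Fact bimod_scaleDl x : {morph bimod_scale^~ x : f g / f + g}.
Proof. by []. Qed.

HB.instance Definition _ := GRing.Nmodule_isLSemiModule.Build rendo^c bimod
  bimod_scaleA bimod_scale0 bimod_scale1 bimod_scaleDr bimod_scaleDl.

End Endomorphisms.

(* R^o is R with R acting by left multiplication, so that the left ideals of R
   are the subsemimodules of R^o. *)
Section IdealSemimodule.
Variables (R : pzSemiRingType) (I : set R) (hI : left_ideal I).

Definition lideal_mod of left_ideal I : Type := {x : R^o | x \in I}.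
Local Notation L := (lideal_mod hI).

HB.instance Definition _ := SubChoice.on L.

Lemma lideal_closed :
  GRing.subsemimod_closed (fun x : R^o => x \in I).
Proof.
case: hI => -[I0 ID] IM; split; first split.
- exact/mem_set.
- by move=> x y /set_mem Ix /set_mem Iy; apply/mem_set/ID.
- by move=> r x /set_mem Ix; apply/mem_set/IM.
Qed.

HB.instance Definition _ :=
  GRing.SubChoice_isSubLSemiModule.Build R R^o (fun x : R^o => x \in I) L
    lideal_closed.

End IdealSemimodule.

Section Corner.
Variables (T : pzSemiRingType) (e : T) (he : e * e = e).

Definition corner of e * e = e : Type :=
  {x : T | x \in [set e * t * e | t in setT]}.
Local Notation C := (corner he).

HB.instance Definition _ := SubChoice.on C.

Lemma cornerP x : x \in [set e * t * e | t in setT] <-> e * x * e = x.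
Proof.
split; last by move=> <-; apply/mem_set; exists x.
by move=> /set_mem[t _ <-]; rewrite !mulrA he -mulrA he.
Qed.

Lemma corner_closed :
  GRing.nmod_closed (fun x : T => x \in [set e * t * e | t in setT]).
Proof.
split=> [|x y]; rewrite !inE; first by exists 0; rewrite // mulr0 mul0r.
by move=> [s _ <-] [t _ <-]; exists (s + t); rewrite // mulrDr mulrDl.
Qed.

HB.instance Definition _ := GRing.SubChoice_isSubNmodule.Build T
  (fun x : T => x \in [set e * t * e | t in setT]) C corner_closed.

Lemma corner_one_in : e \in [set e * t * e | t in setT].
Proof. by apply/cornerP; rewrite he. Qed.

Lemma corner_mul_in (x y : C) :
  val x * val y \in [set e * t * e | t in setT].
Proof.
rewrite inE; exists (val x * val y) => //.
move: (valP x) (valP y) => /cornerP hx /cornerP hy.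
by rewrite -{1}hx -{1}hy !mulrA he -!mulrA he !mulrA hx -[in RHS]hy !mulrA.
Qed.

Definition corner_one : C := Sub e corner_one_in.
Definition corner_mul (x y : C) : C := Sub (val x * val y) (corner_mul_in x y).

Fact corner_mulA : associative corner_mul.
Proof. by move=> x y z; apply: val_inj; rewrite /= mulrA. Qed.
Fact corner_mul1 : left_id corner_one corner_mul.
Proof.
move=> x; apply: val_inj => /=; have /cornerP hx := valP x.
by rewrite -hx !mulrA he.
Qed.
Fact corner_1mul : right_id corner_one corner_mul.
Proof.
move=> x; apply: val_inj => /=; have /cornerP hx := valP x.
by rewrite -hx -!mulrA he.
Qed.
Fact corner_mulDl : left_distributive corner_mul +%R.
Proof. by move=> x y z; apply: val_inj; rewrite /= mulrDl. Qed.
Fact corner_mulDr : right_distributive corner_mul +%R.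
Proof. by move=> x y z; apply: val_inj; rewrite /= mulrDr. Qed.
Fact corner_mul0 : left_zero 0 corner_mul.
Proof. by move=> x; apply: val_inj; rewrite /= mul0r. Qed.
Fact corner_0mul : right_zero 0 corner_mul.
Proof. by move=> x; apply: val_inj; rewrite /= mulr0. Qed.

HB.instance Definition _ := GRing.Nmodule_isPzSemiRing.Build C
  corner_mulA corner_mul1 corner_1mul corner_mulDl corner_mulDr
  corner_mul0 corner_0mul.

End Corner.

(* Main.v *)
(** Since R is ideal-simple, the nonzero two-sided ideal I R is R, so that
    1 = x_1 s_1 + ... + x_n s_n with x_k in I.  Hence the forms
    phi_k : z |-> z s_k from I to R satisfy sum_k phi_k(x_k) = 1, which makes I
    a generator.  Write [psi, y] for the endomorphism z |-> psi(z) y of I.  Then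
    every y in I is sum_k x_k [phi_k, y], which is a dual basis of I_D and gives
    g(y) = (sum_k phi_k(g(x_k))) y for every D-endomorphism g of I_D.  The map
    r |-> ([phi_k, r x_l])_(k,l) identifies R with e M_n(D) e, where e is the
    image of 1.

    The sums of endomorphisms [psi, y] form a nonzero ideal of D; if D is
    ideal-simple it contains 1 = sum_j [psi_j, b_j], which is a dual basis of
    the R-semimodule I.  Conversely, given such a dual basis, a nonzero ideal J
    of D contains 1 since the ideal of R generated by the phi(d(z)), d in J, is
    R; and a congruence E on D is pulled back to the congruence of R relating r
    and s when [psi, r y] E [psi, s y] for all psi and y. *)

Require Import Defs.
From HB Require Import structures.
From mathcomp Require Import all_boot all_algebra.
From mathcomp Require Import boolp classical_sets functions cardinality.

Set Implicit Arguments.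
Unset Strict Implicit.
Unset Printing Implicit Defensive.

Import GRing.Theory.

Local Open Scope classical_set_scope.
Local Open Scope ring_scope.

(** * Building linear maps, and writing 1 as a finite sum *)

Definition linear_of (R : pzSemiRingType) (M N : lSemiModType R) (f : M -> N)
    (fZ : scalable f) (fD : {morph f : x y / x + y}) : {linear M -> N} :=
  HB.pack_for {linear M -> N} f
    (GRing.isSemilinear.Build R M N *:%R f (fZ, fD)).

(** The finite sums of elements of [S] form a nonzero two-sided ideal, hence all of [R]. As [S] need
    not be closed under addition, it can consist of single products. *)
Lemma exists_sum1 (R : pzSemiRingType) (S : set R) :
  ideal_simple R -> (forall r x, S x -> S (r * x) /\ S (x * r)) ->
  (exists2 x, S x & x != 0) ->
  exists (n : nat) (u : 'I_n -> R), (forall k, S (u k)) /\ \sum_k u k = 1.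
Proof.
move=> simpleR SM [x Sx x_neq0].
pose J y := exists2 s : seq R, {in s, forall z, S z} & \sum_(z <- s) z = y.
have /simpleR[J0|JT] : two_sided_ideal J.
- split=> [|r y [s Ss <-]]; last split.
  + split=> [|_ _ [s Ss <-] [t St <-]]; first by exists [::]; rewrite ?big_nil.
    exists (s ++ t); last by rewrite big_cat.
    by move=> z; rewrite mem_cat => /orP[/Ss|/St].
  + exists [seq r * z | z <- s]; last by rewrite big_map mulr_sumr.
    by move=> _ /mapP[z /Ss Sz ->]; exact: (SM r z Sz).1.
  + exists [seq z * r | z <- s]; last by rewrite big_map mulr_suml.
    by move=> _ /mapP[z /Ss Sz ->]; exact: (SM r z Sz).2.
- have : J x
    by exists [:: x]; rewrite ?big_seq1 // => z; rewrite inE => /eqP ->.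
  by rewrite J0 /= => x0; rewrite x0 eqxx in x_neq0.
- have : J 1 by rewrite JT.
  move=> [s Ss s1]; exists (size s), (tnth (in_tuple s)).
  by split=> [k|]; [apply/Ss/mem_tnth | rewrite -s1 [RHS]big_tnth].
Qed.

(** * Free semimodules, dual bases and generators *)

Section FreeSemimodules.
Variable R : pzSemiRingType.
Implicit Types M : lSemiModType R.

Lemma dsum_sumE (X : choiceType) M (J : Type) (s : seq J) (F : J -> dsum X M)
    x :
  (\sum_(j <- s) F j : dsum X M) x = \sum_(j <- s) F j x.
Proof. exact: (big_morph (fun f : dsum X M => f x)). Qed.

Definition coord (X : choiceType) M (x : X) : {linear dsum X M -> M} :=
  @linear_of _ (dsum X M) M (fun f => f x)
    (fun _ _ => erefl) (fun _ _ => erefl).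

Section Basis.
Variable X : choiceType.

Lemma unit_vec_subproof (x : X) :
  (fun y => (y == x)%:R : R^o) \in @fin_supp R X R^o.
Proof.
apply/asboolP; apply: sub_finite_set (finite_set1 x) => y /=.
by case: (eqVneq y x) => // _ /negP[]; apply/eqP.
Qed.

Definition unit_vec x : dsum X R^o := DSum (unit_vec_subproof x).

Lemma dsum_supp (f : dsum X R^o) :
  exists s : seq X, forall x, x \notin s -> f x = 0.
Proof.
case: f => f /= /asboolP/finite_seqP[s fs]; exists s => x.
move=> xs; apply/eqP; apply: contraNT xs => fx.
by have : [set` s] x by rewrite -fs.
Qed.

Lemma dsum_basis (f : dsum X R^o) (s : seq X) :
  uniq s -> (forall x, x \notin s -> f x = 0) ->
  f = \sum_(x <- s) (f x : R) *: unit_vec x.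
Proof.
move=> s_uniq fs; apply/val_inj/funext => y; rewrite /= dsum_sumE.
have [ys|ys] := boolP (y \in s); last first.
  rewrite fs // big_seq big1 // => x xs.
  rewrite /= /GRing.scale /=; case: eqVneq => [yx|_]; last by rewrite mulr0.
  by rewrite yx xs in ys.
rewrite (bigD1_seq y) //= big1 => [|x xy].
  by rewrite /GRing.scale /= eqxx mulr1 addr0.
by rewrite /GRing.scale /= eq_sym (negPf xy) mulr0.
Qed.

End Basis.

Section FiniteSums.
Variables (n : nat) (M N : lSemiModType R).

Lemma fin_supp_ord (f : 'I_n -> M) : f \in @fin_supp R 'I_n M.
Proof.
by apply/asboolP/(@sub_finite_set _ _ setT) => //; exact: finite_finset.
Qed.

(** A finite direct sum is also a product; [to_dsum] and [of_dsum] are its two universal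
    properties. *)
Definition to_dsum (F : 'I_n -> {linear N -> M}) : {linear N -> dsum 'I_n M}.
Proof.
apply: (@linear_of _ N (dsum 'I_n M) (fun y => DSum (fin_supp_ord (F ^~ y)))).
  by move=> a y; apply/val_inj/funext => k /=; rewrite linearZ.
by move=> y z; apply/val_inj/funext => k /=; rewrite linearD.
Defined.

Definition of_dsum (F : 'I_n -> {linear M -> N}) : {linear dsum 'I_n M -> N}.
Proof.
apply: (@linear_of _ (dsum 'I_n M) N (fun f => \sum_k F k (f k))).
  by move=> a f; rewrite scaler_sumr; apply: eq_bigr => k _; exact: linearZ.
by move=> f g; rewrite -big_split; apply: eq_bigr => k _; exact: linearD.
Defined.

End FiniteSums.

Definition scale_vec M (b : M) : {linear R^o -> M} :=
  @linear_of _ R^o M (fun r => (r : R) *: b)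
    (fun a r => esym (scalerA a r b)) (fun r s => scalerDl b (r : R) s).

(** The forms [psi j] give a section of the map from the free semimodule of rank [n] sending basis
    vectors to the [b j]. *)
Lemma dual_basis_fgp M n (b : 'I_n -> M) (psi : 'I_n -> {linear M -> R^o}) :
  (forall x, x = \sum_j (psi j x : R) *: b j) ->
  finitely_generated M /\ projective M.
Proof.
move=> bpsi; pose p := of_dsum (fun j => scale_vec (b j)).
have ps : cancel (to_dsum psi) p by move=> x; rewrite [RHS]bpsi.
split; last by exists 'I_n, (to_dsum psi), p.
by exists n, p => x; exists (to_dsum psi x).
Qed.

(** The basis [X] may be infinite, but finitely many generators have images under [s] supported in a
    finite set [T], and the coordinates in [T] suffice. *)
Lemma fgp_dual_basis M : finitely_generated M -> projective M ->
  exists (n : nat) (b : 'I_n -> M) (psi : 'I_n -> {linear M -> R^o}),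
    forall x, x = \sum_j (psi j x : R) *: b j.
Proof.
move=> [m [q q_surj]] [X [s [p ps]]].
have [S S_supp] := choice (fun j => dsum_supp (s (q (unit_vec j)))).
(* Repetitions are removed so that [dsum_basis] counts each coordinate once. *)
pose T := undup (flatten [seq S j | j <- enum 'I_m]).
have s_supp y x : x \notin T -> s y x = 0.
  move=> xT; have [c <-] := q_surj y.
  rewrite (@dsum_basis _ c (enum 'I_m)) ?enum_uniq //; last first.
    by move=> j; rewrite mem_enum.
  rewrite !linear_sum dsum_sumE big1 // => j _.
  rewrite !linearZ /= S_supp ?scaler0 //; apply: contra xT => xS.
  by rewrite mem_undup; apply/flatten_mapP; exists j; rewrite ?mem_enum.
exists (size T), (fun j => p (unit_vec (tnth (in_tuple T) j))).
exists (fun j => coord R^o (tnth (in_tuple T) j) \o s : {linear M -> R^o}) => y.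
rewrite -[LHS]ps (dsum_basis (undup_uniq _) (s_supp y)) linear_sum big_tnth.
by apply: eq_bigr => j _; rewrite linearZ.
Qed.

(** The map sending [r] to the family of [r *: x k] is a section of the sum of the [phi k]. *)
Lemma generator_trace M n (x : 'I_n -> M) (phi : 'I_n -> {linear M -> R^o}) :
  \sum_k phi k (x k) = 1 -> generator M.
Proof.
move=> trace1; exists n, (to_dsum (fun k => scale_vec (x k))), (of_dsum phi).
move=> r; rewrite /= -[RHS]mulr1 -trace1 mulr_sumr; apply: eq_bigr => k _.
by rewrite linearZ.
Qed.

End FreeSemimodules.

(** * Rank-one endomorphisms and the Morita context between [R] and [D] *)

Section EndomorphismSemirings.
Variables (R : pzSemiRingType) (M : lSemiModType R).
Local Notation D := (rendo M).
Local Notation MD := (bimod M : rSemiModType D).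
Implicit Types (r s : R) (x y z : M) (psi : {linear M -> R^o}).

Definition app (d : D) : {linear M -> M} := (d : endo M).

Lemma rendoP (c d : D) : (forall z, app c z = app d z) -> c = d.
Proof. exact: endoP. Qed.

Lemma app_mul (c d : D) z : app (c * d) z = app d (app c z).
Proof. by []. Qed.

Lemma app_sum (J : Type) (s : seq J) (F : J -> D) z :
  app (\sum_(j <- s) F j) z = \sum_(j <- s) app (F j) z.
Proof. exact: (big_morph (fun d : D => app d z)). Qed.

(** This is the rank-one endomorphism [[psi, y]], the [D]-valued pairing of the Morita context. *)
Definition outer psi y : D.
Proof.
apply: (@linear_of _ M M (fun z => (psi z : R) *: y) _ _ : endo M) => [a z|z t].
  by rewrite linearZ scalerA.
by rewrite linearD; exact: (scalerDl y (psi z : R)).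
Defined.

Lemma outerE psi y z : app (outer psi y) z = (psi z : R) *: y.
Proof. by []. Qed.

(** The right action of [R] on the dual of [M]. *)
Definition mulr_form psi r : {linear M -> R^o}.
Proof.
apply: (@linear_of _ M R^o (fun z => (psi z : R) * r)) => [a z|z t].
  by rewrite linearZ [LHS]/= -mulrA.
by rewrite linearD [LHS]mulrDl.
Defined.

(** With [mul_outer], this makes the set of all [[psi, y]] stable under multiplication by [D] on
    both sides. *)
Lemma outer_mul psi y (d : D) : outer psi y * d = outer psi (app d y).
Proof. by apply: rendoP => z; rewrite app_mul !outerE linearZ. Qed.

Lemma mul_outer psi y (d : D) :
  d * outer psi y = outer (psi \o app d : {linear M -> R^o}) y.
Proof. exact: rendoP. Qed.

Lemma outer_sum psi (J : Type) (s : seq J) (F : J -> M) :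
  \sum_(j <- s) outer psi (F j) = outer psi (\sum_(j <- s) F j).
Proof. by apply: rendoP => z; rewrite app_sum outerE scaler_sumr. Qed.

Lemma outer0 psi : outer psi 0 = 0.
Proof. by apply: rendoP => z; exact: scaler0. Qed.

Lemma outerD psi x y : outer psi (x + y) = outer psi x + outer psi y.
Proof. by apply: rendoP => z; exact: scalerDr. Qed.

Lemma outer_scaler psi r y : outer psi (r *: y) = outer (mulr_form psi r) y.
Proof. by apply: rendoP => z; rewrite !outerE scalerA. Qed.

Definition lmul r : endo MD.
Proof.
apply: (@linear_of _ MD MD (fun x : M => r *: x)) => [d x|x y].
  by rewrite -[RHS]/(app d (r *: x)) linearZ.
exact: (@scalerDr R M r x y).
Defined.

Lemma lmulE r x : lmul r x = r *: x :> M.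
Proof. by []. Qed.

Fact lmul_nmod_morphism : GRing.nmod_morphism lmul.
Proof.
split=> [|r s]; apply: endoP => x; first exact: (@scale0r R M).
exact: (@scalerDl R M).
Qed.

Fact lmul_monoid_morphism : GRing.monoid_morphism lmul.
Proof.
split=> [|r s]; apply: endoP => x; first exact: (@scale1r R M).
exact: (esym (@scalerA R M r s x)).
Qed.

HB.instance Definition _ := GRing.isNmodMorphism.Build R (endo MD) lmul
  lmul_nmod_morphism.
HB.instance Definition _ := GRing.isMonoidMorphism.Build R (endo MD) lmul
  lmul_monoid_morphism.

Lemma endo_bimodD (g : endo MD) (d : D) x : (g (app d x) : M) = app d (g x).
Proof.
by rewrite -[LHS]/((g : {linear MD -> MD}) ((d : D^c) *: (x : MD))) linearZ.
Qed.

Lemma endo_bimod_sum (g : endo MD) (J : Type) (s : seq J) (F : J -> M) :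
  (g (\sum_(j <- s) F j) : M) = \sum_(j <- s) (g (F j) : M).
Proof. exact: (linear_sum (g : {linear MD -> MD})). Qed.

(* trace1 says that M is a generator; the x_k and phi_k give the Morita context
   between R and rendo M explicitly. *)
Section Generator.
Variables (n : nat) (x : 'I_n -> M) (phi : 'I_n -> {linear M -> R^o}).
Hypothesis trace1 : \sum_k (phi k (x k) : R) = 1.

Lemma sum_outer y : \sum_k app (outer (phi k) y) (x k) = y.
Proof.
by under eq_bigr do rewrite outerE; rewrite -scaler_suml trace1 scale1r.
Qed.

Lemma trace_scale r : \sum_k (phi k (r *: x k) : R) = r.
Proof.
rewrite -[RHS]mulr1 -trace1 mulr_sumr; apply: eq_bigr => k _.
by rewrite linearZ.
Qed.

(** Applying a [D]-endomorphism [g] to the expansion [sum_outer] of [y] and moving each [[phi k, y]]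
    outside shows that [g] is multiplication by the sum of the [phi k (g (x k))]. *)
Lemma lmul_bij : bijective lmul.
Proof.
exists (fun g : endo MD => \sum_k (phi k (g (x k)) : R)) => [r|g].
  exact: trace_scale.
apply: endoP => y; rewrite lmulE scaler_suml -[y in RHS]sum_outer.
rewrite endo_bimod_sum; apply: eq_bigr => k _.
by rewrite endo_bimodD.
Qed.

(** For fixed [psi], the pairing is a form on the right [D]-semimodule [M]; these are the
    coordinates of its dual basis. *)
Definition outer_form psi : {linear MD -> (D^c)^o}.
Proof.
apply: (@linear_of _ MD (D^c)^o (fun y : M => outer psi y)) => [d y|y z].
  exact: (esym (outer_mul psi y d)).
exact: outerD.
Defined.

Lemma bimod_fgp : finitely_generated MD /\ projective MD.
Proof.
apply: (@dual_basis_fgp _ MD n x (fun k => outer_form (phi k))) => y.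
exact: (esym (sum_outer y)).
Qed.

Definition outer_mx r : 'M[D]_n := \matrix_(k, l) outer (phi k) (r *: x l).

(** Entry [(k, m)] of the product is the sum over [l] of [[phi k, phi l (r x l) s x m]], and the
    [phi l (r x l)] add up to [r]. *)
Lemma outer_mxM r s : outer_mx (r * s) = outer_mx r * outer_mx s.
Proof.
apply/matrixP => k m; rewrite !mxE.
under eq_bigr do rewrite !mxE outer_mul outerE.
rewrite outer_sum -scaler_suml; congr (outer _ _).
by rewrite trace_scale scalerA.
Qed.

Lemma outer_mx0 : outer_mx 0 = 0.
Proof.
by apply/matrixP => k l; rewrite !mxE scale0r outer0.
Qed.

Lemma outer_mxD r s : outer_mx (r + s) = outer_mx r + outer_mx s.
Proof. by apply/matrixP => k l; rewrite !mxE scalerDl outerD. Qed.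

Lemma outer_mx_inj : injective outer_mx.
Proof.
(* On [outer_mx r] the summands are [phi k (x k) * r * phi l (x l)], with total [1 * r * 1]. *)
pose tr (A : 'M[D]_n) : R := \sum_k \sum_l (phi l (app (A k l) (x k)) : R).
suff trK : cancel outer_mx tr by exact: can_inj trK.
move=> r; rewrite -[RHS]mul1r -trace1 mulr_suml; apply: eq_bigr => k _.
rewrite -[r in RHS]mulr1 -trace1 !mulr_sumr; apply: eq_bigr => l _.
by rewrite mxE outerE !linearZ.
Qed.

Lemma outer_mx1_idem : outer_mx 1 * outer_mx 1 = outer_mx 1.
Proof. by rewrite -outer_mxM mulr1. Qed.

Lemma outer_mx_onto (A : 'M[D]_n) :
  exists r, outer_mx r = outer_mx 1 * A * outer_mx 1.
Proof.
(* The left inverse of [outer_mx] used for injectivity, evaluated at [A]. *)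
exists (\sum_l \sum_j (phi j (app (A l j) (x l)) : R)).
apply/matrixP => k m; apply: rendoP => z; rewrite !mxE app_sum outerE.
(* Products in [D] apply the left factor first: [[phi k, x l]], then [A l j], then
   [[phi j, x m]]. *)
transitivity (\sum_j \sum_l app (outer (phi j) (x m))
    (app (A l j) (app (outer (phi k) (x l)) z))).
  rewrite scalerA mulr_sumr scaler_suml exchange_big; apply: eq_bigr => l _.
  rewrite mulr_sumr scaler_suml; apply: eq_bigr => j _.
  by rewrite !outerE !linearZ.
apply: eq_bigr => j _; rewrite !mxE mulr_suml app_sum; apply: eq_bigr => l _.
by rewrite !mxE !app_mul !scale1r.
Qed.

Definition outer_corner r : corner outer_mx1_idem.
Proof.
exists (outer_mx r); apply/mem_set; exists (outer_mx r) => //.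
by rewrite -!outer_mxM mul1r mulr1.
Defined.

Fact outer_corner_nmod_morphism : GRing.nmod_morphism outer_corner.
Proof.
by split=> [|r s]; apply: val_inj; [exact: outer_mx0 | exact: outer_mxD].
Qed.

Fact outer_corner_monoid_morphism : GRing.monoid_morphism outer_corner.
Proof. by split=> [|r s]; apply: val_inj; last exact: outer_mxM. Qed.

HB.instance Definition _ := GRing.isNmodMorphism.Build R (corner outer_mx1_idem)
  outer_corner outer_corner_nmod_morphism.
HB.instance Definition _ := GRing.isMonoidMorphism.Build R
  (corner outer_mx1_idem) outer_corner outer_corner_monoid_morphism.

Lemma outer_corner_iso : semiring_isomorphic R (corner outer_mx1_idem).
Proof.
exists outer_corner.
have onto (A : corner outer_mx1_idem) : exists r, outer_corner r = A.
  have AE := iffLR (cornerP outer_mx1_idem (val A)) (valP A).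
  have [r rA] := outer_mx_onto (val A).
  by exists r; apply: val_inj; exact: etrans rA AE.
have [g gK] := choice onto.
by exists g => // r; apply: outer_mx_inj; rewrite -[LHS]/(val (outer_corner _)) gK.
Qed.

(** Ideal-simplicity of [D] writes 1 as a sum of rank-one endomorphisms [[psi j, b j]]; evaluated at
    [z], this is the dual basis expansion. *)
Lemma simple_fgp (z0 : M) : z0 != 0 -> ideal_simple D ->
  finitely_generated M /\ projective M.
Proof.
move=> z0_neq0 simpleD.
have [||m [u [/choice[psi] /choice[b]]]] :=
    @exists_sum1 D [set d | exists psi y, d = outer psi y] simpleD.
- move=> c _ [psi [y ->]]; split.
    by rewrite mul_outer; exists (psi \o app c : {linear M -> R^o}), y.
  by rewrite outer_mul; exists psi, (app c y).
(* If all [[phi k, z0]] vanished, so would [z0], by [sum_outer]. *)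
- apply: contrapT => outer0; move/eqP: z0_neq0; apply.
  rewrite -(sum_outer z0) big1 // => k _.
  have -> : outer (phi k) z0 = 0; last by [].
  apply/eqP; apply: contrapT => /negP outer_neq0; apply: outer0.
  by exists (outer (phi k) z0); first by exists (phi k), z0.
- move=> uE u1; apply: (@dual_basis_fgp _ M m b psi) => z.
  rewrite -[LHS]/(app 1 z) -u1 app_sum; apply: eq_bigr => j _.
  by rewrite uE.
Qed.

End Generator.

(** * Transfer of simplicity from [R] to [D] along a dual basis of [M] *)

Section DualBasis.
Variables (n : nat) (b : 'I_n -> M) (psi : 'I_n -> {linear M -> R^o}).
Hypothesis psib : forall z, z = \sum_j (psi j z : R) *: b j.

Lemma forms_separate z t :
  (forall phi : {linear M -> R^o}, phi z = phi t) -> z = t.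
Proof.
by move=> zt; rewrite (psib z) (psib t); apply: eq_bigr => j _; rewrite zt.
Qed.

Lemma sum_outer_dual : \sum_j outer (psi j) (b j) = 1.
Proof. by apply: rendoP => z; rewrite app_sum [RHS]psib. Qed.

Lemma dual_basis_ideal_simple : ideal_simple R -> ideal_simple D.
Proof.
move=> simpleR J [[J0 JD] JM].
have [J_eq0|[d Jd d_neq0]] :
    (forall d, J d -> d = 0) \/ exists2 d, J d & d != 0.
- have [/asboolP|] := boolP `[<exists2 d, J d & d != 0>]; first by right.
  move/asboolPn => J_eq0; left => d Jd; apply: contrapT => /eqP d_neq0.
  by apply: J_eq0; exists d.
- by left; apply/seteqP; split=> [d /J_eq0|_ ->].
right; apply/seteqP; split=> // c _; rewrite -[c]mul1r; apply: (JM c 1 _).2.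
pose S : set R :=
  [set r | exists (phi : {linear M -> R^o}) d z, J d /\ r = phi (app d z)].
have [||m [u [uS u1]]] := @exists_sum1 R S simpleR.
- move=> r _ [phi [e [z [Je ->]]]]; split.
    by exists phi, e, (r *: z); split=> //; rewrite !linearZ.
  by exists (mulr_form phi r), e, z.
(* If [S] had only zero values, every form would vanish on the image of [d], forcing [d = 0]. *)
- apply: contrapT => S0; move/eqP: d_neq0; apply; apply: rendoP => z.
  apply: forms_separate => phi; rewrite [RHS]linear0.
  apply: contrapT => /eqP phi_neq0.
  by apply: S0; exists (phi (app d z)) => //; exists phi, d, z.
have J_sum k (F : 'I_k -> D) : (forall i, J (F i)) -> J (\sum_i F i).
  by move=> JF; apply: big_ind => //.
rewrite -sum_outer_dual; apply/J_sum => j.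
(* Inserting [1 = \sum_t u t] before [b j] splits [[psi j, b j]] into terms that factor through
   elements of [J]. *)
rewrite -[b j]scale1r -u1 scaler_suml -outer_sum; apply/J_sum => t.
have [phi [e [z [Je ->]]]] := uS t.
have -> : outer (psi j) ((phi (app e z) : R) *: b j) =
    outer (psi j) z * e * outer phi (b j).
  by rewrite outer_mul outer_mul outerE.
by apply: (JM _ _ _).2; apply: (JM _ _ _).1.
Qed.

Lemma dual_basis_congruence_simple : congruence_simple R -> congruence_simple D.
Proof.
move=> simpleR E [E_refl E_sym E_trans E_add E_mul].
pose F r s :=
  forall (phi : {linear M -> R^o}) y, E (outer phi (r *: y)) (outer phi (s *: y)).
have F_cong : congruence F.
  split=> [r|r s rs|r s t rs st|r s t u rs tu|r s t u rs tu] phi y.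
  - exact: E_refl.
  - exact/E_sym/rs.
  - exact: E_trans (rs phi y) (st phi y).
  - by rewrite !scalerDl !outerD; exact: E_add.
  (* For the second half, [s] moves from the vector into the form, so that the relation of [t] and
     [u] applies. *)
  - apply: E_trans (_ : E (outer phi ((s * t) *: y)) _).
      by rewrite -!scalerA; exact: rs.
    by rewrite -!scalerA ![outer phi (s *: _)]outer_scaler; exact: tu.
have [F_eq|F_all] := simpleR F F_cong; [left|right].
  move=> c d; split=> [cd|->]; last exact: E_refl.
  apply: rendoP => z; apply: forms_separate => phi; apply/F_eq => psi' y.
  (* This product formula turns [E c d] into [F (phi (c z)) (phi (d z))], which is an equality
     here. *)
  have outer_app e :
      outer psi' ((phi (app e z) : R) *: y) = outer psi' z * e * outer phi y.
    by rewrite outer_mul outer_mul outerE.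
  by rewrite !outer_app; apply/E_mul/E_refl; apply/E_mul.
(* When [F] is total, each [[psi j, b j]] is related to 0; hence so is their sum 1, and [E] is
   total. *)
have E10 : E 1 0.
  have <- : \sum_(j < n) 0 = 0 :> D by rewrite big1.
  rewrite -sum_outer_dual.
  apply: (big_ind2 E) => // j _.
  by have := F_all 1 0 (psi j) (b j); rewrite scale1r scale0r outer0.
move=> c d; apply: E_trans (_ : E 0 d).
  by rewrite -[c]mulr1 -[0](mulr0 c); exact: E_mul.
by apply: E_sym; rewrite -[d]mulr1 -[0](mulr0 d); exact: E_mul.
Qed.

End DualBasis.
End EndomorphismSemirings.

(** * Left ideals of a simple semiring, and the theorem *)

Lemma left_ideal_trace (R : pzSemiRingType) (I : set R) (hI : left_ideal I) :
  ideal_simple R -> (exists2 x, I x & x != 0) ->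
  exists (n : nat) (x : 'I_n -> lideal_mod hI)
      (phi : 'I_n -> {linear lideal_mod hI -> R^o}),
    \sum_k (phi k (x k) : R) = 1.
Proof.
move=> simpleR [x0 Ix0 x0_neq0].
have [||n [u [uS u1]]] :=
    @exists_sum1 R [set r | exists (x : lideal_mod hI) s, r = val x * s]
      simpleR.
- move=> r _ [x [s ->]]; split; last by exists x, (s * r); rewrite mulrA.
  by exists (r *: x), s; rewrite mulrA.
- exists x0 => //; exists (exist _ x0 (mem_set Ix0) : lideal_mod hI), 1.
  by rewrite mulr1.
have [x /choice[s us]] := choice uS.
(* Each form is the inclusion of [I] in [R] followed by right multiplication by [s k]. *)
exists n, x, (fun k => mulr_form (val : {linear lideal_mod hI -> R^o}) (s k)).
by rewrite -u1; apply: eq_bigr => k _; rewrite us.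
Qed.

Theorem theorem5p10 (R : pzSemiRingType) (R_simple : simple_semiring R)
    (I : set R) (hI : left_ideal I) (I_neq0 : exists2 x, I x & x != 0) :
  let RI : lSemiModType R := lideal_mod hI in
  let D : pzSemiRingType := rendo RI in
  let ID : rSemiModType D := bimod RI in
  [/\ exists2 f : {rmorphism R -> endo ID},
        (forall (r : R) (i : RI), val ((f r : endo ID) i : RI) = r * val i) & bijective f,
      generator RI,
      finitely_generated ID /\ projective ID,
      exists (n : nat) (e : 'M[D]_n) (he : e * e = e),
        [/\ (0 < n)%N, e != 0 & semiring_isomorphic R (corner he)]
    & simple_semiring D <-> finitely_generated RI /\ projective RI].
Proof.
move=> RI D ID; have [R_ideal_simple R_congr_simple] := R_simple.
have [n [x [phi trace1]]] := left_ideal_trace hI R_ideal_simple I_neq0.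
have [x0 Ix0 x0_neq0] := I_neq0.
have one_neq0 : (1 : R) != 0.
  by apply: contraNneq x0_neq0 => one0; rewrite -[x0]mul1r one0 mul0r.
split.
- by exists (@lmul R RI); [|exact: lmul_bij trace1].
- exact: generator_trace trace1.
- exact: bimod_fgp trace1.
- exists n, (outer_mx x phi 1), (outer_mx1_idem trace1); split.
  (* For [n = 0] the empty trace would give [0 = 1] in [R]. *)
  + case: n x phi trace1 => // x phi; rewrite big_ord0 => /eqP.
    by rewrite eq_sym (negPf one_neq0).
  + by rewrite -(outer_mx0 x phi) (inj_eq (outer_mx_inj trace1)).
  + exact: outer_corner_iso.
split=> [[D_ideal_simple _]|[/fgp_dual_basis fg /fg[m [b [psi psib]]]]].
  apply: (simple_fgp trace1 _ D_ideal_simple).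
  have : (exist _ x0 (mem_set Ix0) : RI) != 0 by rewrite -val_eqE.
  exact.
split; first exact: dual_basis_ideal_simple psib R_ideal_simple.
exact: dual_basis_congruence_simple psib R_congr_simple.
Qed.
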